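(* Let $K:\mathbb R^2\setminus\Delta\to\mathbb C$ satisfy the smoothness condition of a standard Calderón–Zygmund kernel: for some $0<\delta\le1$ and $C>0$, $$|K(t,x)-K(t',x')|\le C\frac{(|t-t'|+|x-x'|)^\delta}{|t-x|^{1+\delta}}\quad\text{whenever } 2(|t-t'|+|x-x'|)<|t-x|.$$ Suppose that the operator $T$ associated with $K$ satisfies the weak boundedness condition. Then $K$ satisfies the decay condition of a standard Calderón–Zygmund kernel: there is $C'>0$ such that $|K(t,x)|\le C'\frac1{|t-x|}$ for all $(t,x)\in\mathbb R^2\setminus\Delta$.
   Context: $\Delta$ is the diagonal of $\mathbb R^2$. For an integer $N\ge 1$, $\mathcal S_N(\mathbb R)$ is the space of $f\in C^N(\mathbb R)$ with $\sup_x |x|^m|f^{(n)}(x)|<\infty$ for all $0\le m,n\le N$, with the topology given by these seminorms; $\mathcal S_N'(\mathbb R)$ is its dual. $T$ is associated with $K$ if, for some $N\ge1$, $T:\mathcal S_N(\mathbb R)\to\mathcal S_N'(\mathbb R)$ is linear and continuous and $\langle T(f),g\rangle=\int\int f(t)g(x)K(t,x)\,dt\,dx$ for all $f,g\in\mathcal S_N(\mathbb R)$ with disjoint compact supports. For an interval $I$ with centre $c(I)$ and length $|I|$, $\phi\in\mathcal S_N(\mathbb R)$ is an $L^2$-normalized bump function adapted to $I$ with constant $C$ and order $N$ if $|\phi^{(n)}(x)|\le C|I|^{-1/2-n}(1+|I|^{-1}|x-c(I)|)^{-N}$ for $0\le n\le N$. $T$ satisfies the weak boundedness condition if for every interval $I$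 and every pair $\phi_I,\varphi_I$ of $L^2$-normalized bump functions adapted to $I$ with constant $C>0$ and order $N$ one has $|\langle T(\phi_I),\varphi_I\rangle|\lesssim C^2$, with implicit constant depending only on $T$. *)

(* Defs.v *)
From HB Require Import structures.
From mathcomp Require Import all_boot all_order all_algebra.
From mathcomp Require Import all_classical all_reals all_analysis.
From mathcomp Require Import complex.

Set Implicit Arguments.
Unset Strict Implicit.
Unset Printing Implicit Defensive.

Import Order.TTheory GRing.Theory Num.Theory.
Import numFieldNormedType.Exports.

Local Open Scope classical_set_scope.
Local Open Scope ring_scope.
Local Open Scope complex_scope.

(* [normc] is the complex modulus with values in R, whereas [`|z|] lives in
   R[i]. *)
Notation normc := ComplexField.Normc.normc.

Section complex_valued.
Context {R : realType}.

Definition re (f : R -> R[i]) : R -> R := fun x => complex.Re (f x).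
Definition im (f : R -> R[i]) : R -> R := fun x => complex.Im (f x).

(* R[i] is not a normed module over R in the library, so derivatives and
   integrals of functions R -> R[i] are taken componentwise. *)
Definition cderivn (n : nat) (f : R -> R[i]) : R -> R[i] :=
  fun x => derive1n n (re f : R -> R^o) x +i* derive1n n (im f : R -> R^o) x.

Definition cintegral (f : R -> R[i]) : R[i] :=
  Rintegral lebesgue_measure setT (re f) +i*
  Rintegral lebesgue_measure setT (im f).

Definition Cn_real (N : nat) (g : R -> R) : Prop :=
  (forall n x, (n < N)%N -> derivable (derive1n n g : R -> R^o) x 1) /\
  continuous (derive1n N g).

Definition Cn (N : nat) (f : R -> R[i]) : Prop :=
  Cn_real N (re f) /\ Cn_real N (im f).

Definition weighted (m n : nat) (f : R -> R[i]) : set R :=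
  [set `|x| ^+ m * normc (cderivn n f x) | x in setT].

Definition seminorm (m n : nat) (f : R -> R[i]) : R := sup (weighted m n f).

Definition in_SN (N : nat) (f : R -> R[i]) : Prop :=
  Cn N f /\
  forall m n, (m <= N)%N -> (n <= N)%N -> has_ubound (weighted m n f).

Lemma derive1n_lincomb N (a b : R) (g h : R -> R) :
  Cn_real N g -> Cn_real N h ->
  forall n, (n <= N)%N ->
  derive1n n (fun x => a * g x + b * h x : R^o) =
  fun x => a * derive1n n g x + b * derive1n n h x.
Proof.
move=> [dg _] [dh _]; elim=> [//|n IH] nN.
rewrite !derive1nS IH ?(ltnW nN)//; apply/funext => x.
rewrite !derive1E.
have dgx := dg n x nN; have dhx := dh n x nN.
rewrite (@deriveD _ _ _ (a *: derive1n n g : R -> R^o) (b *: derive1n n h));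
  [|exact: derivableZ..].
by rewrite !deriveZ.
Qed.

Lemma Cn_real_lincomb N (a b : R) (g h : R -> R) :
  Cn_real N g -> Cn_real N h -> Cn_real N (fun x => a * g x + b * h x).
Proof.
move=> Cg Ch; split=> [n x nN|].
  rewrite (derive1n_lincomb a b Cg Ch (ltnW nN)).
  apply: (@derivableD _ _ _ (a *: derive1n n g : R -> R^o)
    (b *: derive1n n h)); apply: derivableZ; [exact: Cg.1|exact: Ch.1].
rewrite (derive1n_lincomb a b Cg Ch (leqnn N)) => x.
by apply: cvgD; apply: cvgM; [exact: cvg_cst|exact: Cg.2|exact: cvg_cst|
  exact: Ch.2].
Qed.

Lemma ReD (z w : R[i]) : complex.Re (z + w) = complex.Re z + complex.Re w.
Proof. by case: z w => ? ? [? ?]. Qed.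

Lemma ImD (z w : R[i]) : complex.Im (z + w) = complex.Im z + complex.Im w.
Proof. by case: z w => ? ? [? ?]. Qed.

Lemma ReM (z w : R[i]) :
  complex.Re (z * w) = complex.Re z * complex.Re w - complex.Im z * complex.Im w.
Proof. by case: z w => ? ? [? ?]. Qed.

Lemma ImM (z w : R[i]) :
  complex.Im (z * w) = complex.Re z * complex.Im w + complex.Im z * complex.Re w.
Proof. by case: z w => ? ? [? ?]. Qed.

Lemma re_lincomb (a : R[i]) (f g : R -> R[i]) :
  re (fun x => a * f x + g x) =
  fun x => 1 * (complex.Re a * re f x + - complex.Im a * im f x) + 1 * re g x.
Proof. by apply/funext => x; rewrite /re /im ReD ReM !mul1r mulNr. Qed.

Lemma im_lincomb (a : R[i]) (f g : R -> R[i]) :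
  im (fun x => a * f x + g x) =
  fun x => 1 * (complex.Re a * im f x + complex.Im a * re f x) + 1 * im g x.
Proof. by apply/funext => x; rewrite /re /im ImD ImM !mul1r. Qed.

Lemma Cn_lincomb N (a : R[i]) (f g : R -> R[i]) :
  Cn N f -> Cn N g -> Cn N (fun x => a * f x + g x).
Proof.
move=> [f1 f2] [g1 g2].
by split; rewrite ?re_lincomb ?im_lincomb;
  apply: Cn_real_lincomb => //; apply: Cn_real_lincomb.
Qed.

Lemma cderivn_lincomb N (a : R[i]) (f g : R -> R[i]) n :
  Cn N f -> Cn N g -> (n <= N)%N ->
  cderivn n (fun x => a * f x + g x) =
  fun x => a * cderivn n f x + cderivn n g x.
Proof.
move=> [f1 f2] [g1 g2] nN; apply/funext => x.
rewrite {1}/cderivn re_lincomb im_lincomb.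
rewrite !(@derive1n_lincomb N) //; try exact: Cn_real_lincomb.
by case: a => p q /=; apply/eqP; rewrite eq_complex /= !mul1r mulNr !eqxx.
Qed.

Lemma derive1n_zero n : derive1n n (fun=> 0 : R^o) = (fun=> 0 : R).
Proof.
elim: n => [//|n IH]; rewrite derive1nS IH.
by apply/funext => x; rewrite derive1_cst.
Qed.

Lemma cderivn_zero n : cderivn n (fun=> 0 : R[i]) = fun=> 0.
Proof. by apply/funext => x; rewrite /cderivn /re /im derive1n_zero. Qed.

Lemma Cn_zero N : Cn N (fun=> 0 : R[i]).
Proof.
suff C0 : Cn_real N (fun=> 0) by split.
by split=> [n x _|]; rewrite derive1n_zero; [exact: derivable_cst|
  move=> x; exact: cvg_cst].
Qed.

Lemma normc_ge0 (z : R[i]) : 0 <= normc z.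
Proof. by case: z => a b; exact: sqrtr_ge0. Qed.

Lemma weighted_lincomb_le N (a : R[i]) (f g : R -> R[i]) m n A B :
  Cn N f -> Cn N g -> (n <= N)%N ->
  ubound (weighted m n f) A -> ubound (weighted m n g) B ->
  ubound (weighted m n (fun x => a * f x + g x)) (normc a * A + B).
Proof.
move=> Cf Cg nN fA gB _ [x _ <-].
rewrite (cderivn_lincomb a Cf Cg nN).
apply: (@le_trans _ _ (normc a * (`|x| ^+ m * normc (cderivn n f x))
                       + `|x| ^+ m * normc (cderivn n g x))).
  rewrite mulrCA -mulrDr ler_wpM2l ?exprn_ge0//.
  by rewrite -ComplexField.Normc.normcM; exact: le_normcD.
by apply: lerD; [apply: ler_wpM2l; [exact: normc_ge0|apply: fA; exists x]|
  apply: gB; exists x].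
Qed.

Lemma in_SN_zero N : in_SN N (fun=> 0 : R[i]).
Proof.
split=> [|m n _ _]; first exact: Cn_zero.
by exists 0 => _ [x _ <-]; rewrite cderivn_zero ComplexField.Normc.normc0 mulr0.
Qed.

Lemma in_SN_lincomb N (a : R[i]) (f g : R -> R[i]) :
  in_SN N f -> in_SN N g -> in_SN N (fun x => a * f x + g x).
Proof.
move=> [Cf bf] [Cg bg]; split=> [|m n mN nN]; first exact: Cn_lincomb.
have [A fA] := bf m n mN nN; have [B gB] := bg m n mN nN.
by exists (normc a * A + B); apply: (weighted_lincomb_le Cf Cg nN).
Qed.

Definition SN_pred (N : nat) : {pred R -> R[i]^o} := fun f => `[< in_SN N f >].

Lemma SN_submod_closed N : submod_closed (SN_pred N).
Proof.
split=> [|a f g /asboolP Sf /asboolP Sg]; apply/asboolP.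
  exact: in_SN_zero.
exact: in_SN_lincomb.
Qed.

HB.instance Definition _ N :=
  GRing.isSubmodClosed.Build _ _ (SN_pred N) (@SN_submod_closed N).

End complex_valued.

Section SN.
Context {R : realType} {N : nat}.

Record SN : Type :=
  MkSN { SN_fun :> R -> R[i]^o ; _ : SN_fun \in SN_pred N }.

HB.instance Definition _ := [isSub for SN_fun].
HB.instance Definition _ := [Choice of SN by <:].
HB.instance Definition _ := [SubChoice_isSubLmodule of SN by <:].

Lemma SN_in (f : SN) : in_SN N f.
Proof. by case: f => f /= /asboolP. Qed.

Lemma weighted_nonempty m n (f : R -> R[i]) : weighted m n f !=set0.
Proof. by exists (`|0 : R| ^+ m * normc (cderivn n f 0)), 0. Qed.

Lemma seminorm_ub (f : SN) m n : (m <= N)%N -> (n <= N)%N ->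
  ubound (weighted m n f) (seminorm m n f).
Proof.
move=> mN nN; apply: ub_le_sup; exact: (SN_in f).2.
Qed.

Lemma seminormD (f g : SN) m n : (m <= N)%N -> (n <= N)%N ->
  seminorm m n (f + g) <= seminorm m n f + seminorm m n g.
Proof.
move=> mN nN; apply: ge_sup; first exact: weighted_nonempty.
have := weighted_lincomb_le (a := 1) (SN_in f).1 (SN_in g).1 nN
  (seminorm_ub mN nN) (seminorm_ub mN nN).
rewrite ComplexField.Normc.normc1 mul1r.
by congr (ubound (weighted _ _ _) _); apply/funext => x; rewrite mul1r.
Qed.

Lemma seminorm0 m n : seminorm m n (0 : SN) = 0.
Proof.
rewrite /seminorm (_ : weighted _ _ _ = [set 0]) ?sup1//.
have E x : `|x| ^+ m * normc (cderivn n (fun=> 0 : R[i]) x) = 0.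
  by rewrite cderivn_zero ComplexField.Normc.normc0 mulr0.
by apply/seteqP; split=> [_ [x _ <-]|_ ->]; [exact: E|exists 0 => //; exact: E].
Qed.

(* the topology given by the seminorms: basic neighbourhoods of f *)
Definition SN_ball (f : SN) (e : R) : set SN :=
  [set g | forall m n, (m <= N)%N -> (n <= N)%N -> seminorm m n (g - f) < e].

Definition SN_nbhs (f : SN) : set_system SN :=
  filter_from [set e : R | 0 < e] (SN_ball f).

Lemma SN_nbhs_filter (f : SN) : ProperFilter (SN_nbhs f).
Proof.
apply: filter_from_proper; last first.
  by move=> e e0; exists f => m n _ _; rewrite subrr seminorm0.
apply: filter_from_filter; first by exists 1; exact: ltr01.
move=> d e d0 e0; exists (Num.min d e); first by rewrite /= lt_min d0.
by move=> g fg; split=> m n mN nN; have := fg m n mN nN; rewrite lt_min => /andP[].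
Qed.

Lemma SN_nbhs_singleton (f : SN) (A : set SN) : SN_nbhs f A -> A f.
Proof. by move=> [e e0]; apply => m n _ _; rewrite subrr seminorm0. Qed.

Lemma SN_nbhs_nbhs (f : SN) (A : set SN) :
  SN_nbhs f A -> SN_nbhs f (SN_nbhs^~ A).
Proof.
move=> [e e0 fA]; have e20 : 0 < e / 2 by rewrite divr_gt0.
exists (e / 2) => // g fg; exists (e / 2) => // h gh; apply: fA => m n mN nN.
rewrite -(subrKA g) (splitr e); apply: le_lt_trans (seminormD _ _ mN nN) _.
by apply: ltrD; [exact: gh|exact: fg].
Qed.

HB.instance Definition _ := hasNbhs.Build SN SN_nbhs.
HB.instance Definition _ := Nbhs_isNbhsTopological.Build SN
  SN_nbhs_filter SN_nbhs_singleton SN_nbhs_nbhs.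

Definition dual_pred : {pred SN -> R[i]^o} :=
  fun u => `[< linear u /\ continuous u >].

Lemma dual_submod_closed : submod_closed dual_pred.
Proof.
split=> [|a u v /asboolP[lu cu] /asboolP[lv cv]]; apply/asboolP; split.
- by move=> b f g /=; rewrite /GRing.zero /= scaler0 addr0.
- by move=> f; apply: (@cvg_cst _ (0 : R[i]^o)); exact: nbhs_filter.
- move=> b f g; rewrite !fctE lu lv.
  by rewrite !scalerDr !scalerA (mulrC a b) addrACA.
- move=> f; apply: (@cvgD _ _ _ _ _ (a \*: u) v _ _ _ (cv f)).
  by apply: cvgZl_tmp; exact: cu.
Qed.

HB.instance Definition _ :=
  GRing.isSubmodClosed.Build _ _ dual_pred dual_submod_closed.

Record SN_dual : Type :=
  MkSN_dual { SN_dual_fun :> SN -> R[i]^o ; _ : SN_dual_fun \in dual_pred }.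

HB.instance Definition _ := [isSub for SN_dual_fun].
HB.instance Definition _ := [Choice of SN_dual by <:].
HB.instance Definition _ := [SubChoice_isSubLmodule of SN_dual by <:].

(* weak-* topology; for linear maps from the Banach space [SN] into the dual,
   weak-* continuity and norm continuity agree, by uniform boundedness *)
HB.instance Definition _ := Topological.copy SN_dual
  (initial_topology (SN_dual_fun : SN_dual -> {ptws SN -> R[i]^o})).

End SN.
Arguments SN : clear implicits.
Arguments SN_dual : clear implicits.

Section kernels.
Context {R : realType}.

Definition supp (f : R -> R[i]) : set R := closure [set x | f x != 0].

(* A kernel on the plane minus the diagonal is a total function of which only
   the off-diagonal values matter: below, t' != x' follows from
   2 (|t - t'| + |x - x'|) < |t - x|, and in [kernel_associated] the factor
   f t * g x vanishes on the diagonal. *)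
Definition kernel_smoothness (K : R -> R -> R[i]) : Prop :=
  exists delta C : R, [/\ 0 < delta, delta <= 1, 0 < C &
    forall t x t' x', 2 * (`|t - t'| + `|x - x'|) < `|t - x| ->
      normc (K t x - K t' x') <=
      C * ((`|t - t'| + `|x - x'|) `^ delta / `|t - x| `^ (1 + delta))].

Definition kernel_decay (K : R -> R -> R[i]) : Prop :=
  exists2 C : R, 0 < C &
    forall t x, t != x -> normc (K t x) <= C * (1 / `|t - x|).

Definition kernel_associated (N : nat) (T : SN R N -> SN_dual R N)
    (K : R -> R -> R[i]) : Prop :=
  forall f g : SN R N, compact (supp f) -> compact (supp g) ->
    supp f `&` supp g = set0 ->
    T f g = cintegral (fun x => cintegral (fun t => f t * g x * K t x)).

(* bump function adapted to the interval with endpoints a < b *)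
Definition adapted_bump (N : nat) (a b C : R) (phi : SN R N) : Prop :=
  forall n x, (n <= N)%N ->
    normc (cderivn n phi x) <=
    C * (b - a) `^ (- (1 / 2) - n%:R) *
    (1 + (b - a)^-1 * `|x - (a + b) / 2|) ^- N.

Definition weakly_bounded (N : nat) (T : SN R N -> SN_dual R N) : Prop :=
  exists A : R, forall a b C : R, a < b -> 0 < C ->
    forall phi psi : SN R N, adapted_bump a b C phi -> adapted_bump a b C psi ->
    normc (T phi psi) <= A * C ^+ 2.

End kernels.

(* Main.v *)
Require Import Defs.
From mathcomp Require Import all_boot all_order all_algebra.
From mathcomp Require Import all_classical all_reals all_analysis.
From mathcomp Require Import complex.
From mathcomp Require Import ring lra.
Import Order.TTheory GRing.Theory Num.Theory.
Import numFieldNormedType.Exports.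

Local Open Scope classical_set_scope.
Local Open Scope ring_scope.
Local Open Scope complex_scope.

(* Put [r = |t0 - x0|] and test [T] against two nonnegative bumps [F], [G] of
   width [r / 16] around [t0] and [x0]. Both are adapted to the interval between
   [t0] and [x0], so weak boundedness gives [|<T F, G>| <= A r] for sup-normalized
   bumps. Their supports are disjoint, so [<T F, G>] is the integral of
   [F(t) G(x) K(t, x)], and by smoothness [K] differs there from [K(t0, x0)] by
   at most [C / r]. As the integrals of [F] and [G] are at least of order [r],
   dividing by their product bounds [K(t0, x0)] by a multiple of [1 / r]. *)

(** * A compactly supported bump of class C^N *)

Section bump.
Context {R : realType}.

(** A remainder of size [h ^+ 2] puts the difference quotient within [|h|] of [d]. Differentiability
    at the corner of the positive part thus becomes a polynomial inequality in each sign case. *)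
Lemma is_derive1_quadratic (f : R -> R) (x d : R) :
  (forall h, `|f (x + h) - f x - h * d| <= h ^+ 2) ->
  is_derive x 1 (f : R -> R^o) d.
Proof.
move=> fd.
have cv : (fun h : R => h^-1 *: ((f (h *: (1 : R) + x) : R^o) - f x))
    @ 0^' --> (d : R^o).
  apply/cvgrPdist_le => e e0; near=> h.
  have h0 : h != 0 by near: h; exact: nbhs_dnbhs_neq.
  have he : `|h| <= e.
    near: h; apply: dnbhs0_le; exact: e0.
  apply: le_trans he.
  rewrite -(ler_pM2l (x := `|h|)) ?normr_gt0// -normrM -normrM -expr2.
  rewrite [leRHS]ger0_norm ?sqr_ge0// (le_trans _ (fd h))// distrC.
  rewrite /GRing.scale/= mulr1 (addrC h) mulrBr mulrA divff// mul1r.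
  by rewrite le_eqVlt eqxx.
split; first by apply/cvg_ex; exists d.
exact: (cvg_lim _ cv).
Unshelve. all: by end_near. Qed.

Lemma is_derive1_pospart_sq (y : R) :
  is_derive y 1 (fun y => Num.max 0 y ^+ 2 : R^o) (2 * Num.max 0 y).
Proof.
apply: is_derive1_quadratic => h; rewrite ler_norml.
have [] := leP 0 y; have [] := leP 0 (y + h) => ? ?; apply/andP; split; nra.
Qed.

(** The exponents start at 2 because the positive part itself has a corner at 0. Higher powers
    follow by induction and the product rule, after one factor [Num.max 0 y] is replaced by the
    smooth factor [y]. *)
Lemma is_derive1_pospartX (k : nat) (y : R) :
  is_derive y 1 (fun y => Num.max 0 y ^+ k.+2 : R^o)
    (k.+2%:R * Num.max 0 y ^+ k.+1).
Proof.
elim: k y => [|k IH] y; first exact: is_derive1_pospart_sq.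
have pospartXS j : (fun y : R => Num.max 0 y ^+ j.+2) =
    (fun y => y * Num.max 0 y ^+ j.+1).
  apply/funext => z; rewrite exprS.
  by case: leP => // _; rewrite !exprS !mul0r mulr0.
rewrite pospartXS.
apply: (is_derive_eq (@is_deriveM _ _ id _ _ _ _ _ (is_derive_id y 1) (IH y))).
have /= e := congr1 (@^~ y) (pospartXS k).
by rewrite /GRing.scale/= mulr1 e -[k.+3%:R]natr1; set p := _ ^+ k.+1; ring.
Qed.

(** The power [N.+1] of this profile is of class C^N and vanishes outside [-1, 1], so it can play
    the role of the usual exponential bump. *)
Let bumpq (x : R) : R := Num.max 0 (1 - x ^+ 2).

Lemma is_derive1_bump (P : {poly R}) (k : nat) (x : R) :
  is_derive x 1 (fun x => P.[x] * bumpq x ^+ k.+2 : R^o)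
    ((P^`() * (1 - 'X^2) - (2 * k.+2)%:R *: ('X * P)).[x] * bumpq x ^+ k.+1).
Proof.
have d1 : is_derive x 1 (fun x => 1 - x ^+ 2 : R^o) (- (2 * x)).
  have -> : (fun x : R => 1 - x ^+ 2) = horner (1 - 'X^2).
    by apply/funext => y; rewrite hornerD hornerN hornerC hornerXn.
  apply: (is_derive_eq (is_derive_poly _ x)).
  rewrite derivB derivC derivXn sub0r hornerN hornerMn hornerXn expr1 -mulr_natl.
  by [].
have d2 : is_derive x 1 (fun x => bumpq x ^+ k.+2 : R^o)
    (k.+2%:R * bumpq x ^+ k.+1 * - (2 * x)).
  have := @is_derive1_comp _ (fun y => Num.max 0 y ^+ k.+2) _ x _ _
    (is_derive1_pospartX k (1 - x ^+ 2)) d1.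
  by [].
apply: (is_derive_eq (is_deriveM (is_derive_poly P x) d2)).
rewrite /GRing.scale/= hornerD hornerN hornerM hornerD hornerN hornerC hornerXn.
rewrite hornerZ hornerM hornerX.
(* The product rule leaves the full power next to the derivative of [P]. One factor [bumpq x] is
   traded for [1 - x ^+ 2]; where the two differ, the remaining power is zero. *)
have -> : bumpq x ^+ k.+2 = (1 - x ^+ 2) * bumpq x ^+ k.+1.
  by rewrite exprS /bumpq; case: leP => // _; rewrite !exprS !mul0r mulr0.
by rewrite natrM; ring.
Qed.

(* For [n <= N] the [n]-th derivative of [bumpq ^+ N.+1] is a polynomial times a
   positive power of [bumpq], hence continuous with the same support. *)
Lemma derive1n_bump (P : {poly R}) (m n : nat) : exists Q : {poly R},
  derive1n n (fun x => P.[x] * bumpq x ^+ (m + n).+1 : R^o) =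
  (fun x => Q.[x] * bumpq x ^+ m.+1).
Proof.
elim: n m => [|n IH] m; first by exists P; rewrite addn0.
(* Each derivative lowers the exponent by one, so the induction hypothesis is taken with one spare
   power. *)
have [Q QE] := IH m.+1.
exists (Q^`() * (1 - 'X^2) - (2 * m.+2)%:R *: ('X * Q)).
rewrite derive1nS -addSnnS QE; apply/funext => x.
by rewrite derive1E; have [_ ->] := is_derive1_bump Q m x.
Qed.

Lemma bumpq_continuous : continuous bumpq.
Proof.
move=> x.
have := @continuous_max _ _ (cst 0 : R -> R^o) (fun x : R => 1 - x ^+ 2 : R^o) x.
apply.
  exact: cvg_cst.
have -> : (fun x : R => 1 - x ^+ 2) = horner (1 - 'X^2).
  by apply/funext => y; rewrite hornerD hornerN hornerC hornerXn.
exact: continuous_horner.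
Qed.

Lemma bounded_compact_support (h : R -> R) (a b : R) :
  continuous h -> (forall x, ~~ (a <= x <= b) -> h x = 0) ->
  exists2 B, 0 < B & forall x, `|h x| <= B.
Proof.
move=> ch h0; have [ab|ba] := leP a b; last first.
  exists 1 => // x; rewrite h0 ?normr0 ?ler01//; apply/negP => /andP[ax xb].
  by have := lt_le_trans ba (le_trans ax xb); rewrite ltxx.
have [|c _ maxc] := @EVT_max R (fun x => `|h x|) a b ab.
  apply: continuous_subspaceT => x.
  by apply: continuous_comp; [exact: ch|exact: norm_continuous].
exists (`|h c| + 1) => [|x]; first by rewrite ltr_wpDl.
have [xab|/h0 ->] := boolP (a <= x <= b).
  by rewrite (le_trans (maxc x _)) ?in_itv// lerDl.
by rewrite normr0 addr_ge0.
Qed.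

Lemma bump_exists (N : nat) : exists (eta : R -> R) (B c : R),
  [/\ 0 < B, 0 < c, Cn_real N eta & forall x, [/\ 0 <= eta x,
    (`|x| <= 1 / 2 -> c <= eta x),
    (forall n, (n <= N)%N -> `|derive1n n eta x| <= B) &
    (1 <= `|x| -> forall n, (n <= N)%N -> derive1n n eta x = 0)]].
Proof.
pose eta x := (1 : {poly R}).[x] * bumpq x ^+ N.+1.
have dE n : (n <= N)%N -> exists Q : {poly R},
    derive1n n eta = (fun x => Q.[x] * bumpq x ^+ (N - n).+1).
  by move=> nN; have := derive1n_bump 1 (N - n) n; rewrite subnK.
have d0 x : 1 <= `|x| -> forall n, (n <= N)%N -> derive1n n eta x = 0.
  move=> x1 n /dE[Q ->].
  have -> : bumpq x = 0.
    apply/max_idPl; rewrite subr_le0 -(real_normK (num_real x)).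
    by rewrite -[leLHS](expr1n _ 2) lerXn2r ?nnegrE.
  by rewrite exprS mul0r mulr0.
have cn n : (n <= N)%N -> continuous (derive1n n eta).
  move=> /dE[Q ->] x; apply: continuousM.
    exact: (@continuous_horner R Q x).
  apply: (@continuous_comp _ _ _ bumpq (fun y => y ^+ _)).
    exact: bumpq_continuous.
  exact: exprn_continuous.
have [B B0 Bb] : exists2 B, 0 < B & forall n, (n <= N)%N ->
    forall x, `|derive1n n eta x| <= B.
  (* A bound common to all orders is built by induction on the highest order, adding the bound for
     each new derivative. *)
  suff: forall m, (m <= N)%N -> exists2 B, 0 < B & forall n, (n <= m)%N ->
    forall x, `|derive1n n eta x| <= B by apply.
  elim=> [|m IH] mN.
    have [||B B0 Bb] := @bounded_compact_support (derive1n 0 eta) (-1) 1.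
    - exact: (cn 0%N (leq0n N)).
    - by move=> x; rewrite -ler_norml -ltNge => /ltW x1; exact: (d0 x x1 0%N).
    by exists B => // n; rewrite leqn0 => /eqP ->.
  have [B B0 Bb] := IH (ltnW mN).
  have [||B' B'0 Bb'] := @bounded_compact_support (derive1n m.+1 eta) (-1) 1.
  - exact: (cn m.+1 mN).
  - by move=> x; rewrite -ler_norml -ltNge => /ltW x1; exact: (d0 x x1 m.+1).
  exists (B + B') => [|n]; first exact: addr_gt0.
  rewrite leq_eqVlt => /predU1P[->|nm] x.
    by rewrite (le_trans (Bb' x))// lerDr ltW.
  by rewrite (le_trans (Bb n nm x))// lerDl ltW.
(* If |x| <= 1/2 then 1 - x^2 >= 3/4, which gives the lower bound. *)
exists eta, B, ((3 / 4) ^+ N.+1); split => //.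
- split=> [n x nN|]; last exact: cn.
  (* For n < N the n-th derivative still carries an exponent at least 2, as [is_derive1_bump]
     requires. *)
  have := derive1n_bump 1 (N - n.+1).+1 n; rewrite addSnnS subnK//.
  rewrite -/eta => -[Q ->].
  by have [] := is_derive1_bump Q (N - n.+1) x.
move=> x; split => [|x2|n nN|].
- by rewrite /eta hornerC mul1r exprn_ge0// le_max lexx.
- rewrite /eta hornerC mul1r; apply: lerXn2r; rewrite ?nnegrE /bumpq.
  + by lra.
  + by rewrite le_max lexx.
  rewrite le_max; apply/orP; right; move: x2; rewrite ler_norml => /andP[? ?].
  by nra.
- exact: Bb.
- exact: d0.
Qed.

Lemma derive1n_affine (N : nat) (h : R -> R) (a c : R) :
  (forall n x, (n < N)%N -> derivable (derive1n n h : R -> R^o) x 1) ->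
  forall n, (n <= N)%N ->
  derive1n n (fun x => h (a * (x - c)) : R^o) =
  (fun x => a ^+ n * derive1n n h (a * (x - c))).
Proof.
move=> dh; elim=> [_|n IH nN].
  by apply/funext => x; rewrite expr0 mul1r.
rewrite !derive1nS (IH (ltnW nN)); apply/funext => x; rewrite !derive1E.
have d1 : is_derive x 1 (fun x => a * (x - c) : R^o) a.
  apply: (is_derive_eq (@is_deriveZ _ _ _ (fun x => x - c) a _ _ _
    (@is_deriveB _ _ _ id (cst c) _ _ _ _ (is_derive_id x (1 : R))
      (is_derive_cst _ _ _)))).
  by rewrite /GRing.scale/= subr0 mulr1.
have d2 := derivableP (dh n (a * (x - c)) nN).
have d3 := is_deriveZ (a ^+ n) (@is_derive1_comp _ (derive1n n h)
  (fun x => a * (x - c)) _ _ _ d2 d1).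
have [_ ->] := d3; rewrite /GRing.scale/= exprSr; ring.
Qed.

End bump.

(** * Averages of a kernel against two bumps *)

Section integral.
Context {R : realType}.
Local Notation mu := (@lebesgue_measure R).

Lemma integrable_compact_support (h : R -> R) (a b : R) :
  continuous h -> (forall x, ~~ (a <= x <= b) -> h x = 0) ->
  mu.-integrable setT (EFin \o h).
Proof.
move=> ch h0.
have -> : EFin \o h = (EFin \o h) \_ `[a, b].
  apply/funext => x; rewrite /patch; case: ifPn => // xab.
  by rewrite /= h0//; apply: contra xab; rewrite inE/= in_itv.
have mab : measurable (`[a, b]%classic : set R) by [].
apply/(@integrable_mkcond _ _ _ mu _ (EFin \o h) mab).
apply: continuous_compact_integrable; first exact: segment_compact.
exact: continuous_subspaceT.
Qed.

Lemma Rintegral_ge_cst (h : R -> R) (a b c : R) : a <= b ->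
  mu.-integrable setT (EFin \o h) ->
  (forall x, 0 <= h x) -> (forall x, a <= x <= b -> c <= h x) ->
  c * (b - a) <= Rintegral mu setT h.
Proof.
move=> ab ih h0 ch.
have ihab : mu.-integrable `[a, b] (EFin \o h).
  exact: integrableS ih.
have -> : c * (b - a) = Rintegral mu `[a, b] (fun=> c).
  rewrite Rintegral_cst//= lebesgue_measure_itv/= lte_fin.
  have [//|ba] := ltP a b.
  by have -> : b = a; [apply/le_anti; rewrite ab ba|rewrite subrr].
apply: (@le_trans _ _ (Rintegral mu `[a, b] h)).
  apply: le_Rintegral => //.
    apply: continuous_compact_integrable; first exact: segment_compact.
    by apply: continuous_subspaceT => x; exact: cvg_cst.
rewrite Rintegral_mkcond; apply: le_Rintegral => //.
  rewrite -restrict_EFin.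
  have mab : measurable (`[a, b]%classic : set R) by [].
  exact/(@integrable_mkcond _ _ _ mu _ (EFin \o h) mab).
by move=> x _; rewrite /patch; case: ifP => _; [exact: lexx|exact: h0].
Qed.

(** For [s >= 0] this is the nearest-point retraction onto [c - s, c + s]. Being 1-Lipschitz, it
    extends a kernel from a box to the plane with the same Hölder modulus. *)
Definition clamp (c s : R) (x : R) : R := Num.max (c - s) (Num.min (c + s) x).

Variant clamp_spec (c s x : R) : R -> Prop :=
  | ClampLow of x < c - s : clamp_spec c s x (c - s)
  | ClampMid of c - s <= x <= c + s : clamp_spec c s x x
  | ClampHigh of c + s < x : clamp_spec c s x (c + s).

Lemma clampP (c s x : R) : 0 <= s -> clamp_spec c s x (clamp c s x).
Proof.
move=> s0; rewrite /clamp.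
have cs : c - s <= c + s by lra.
have [xs|sx] := leP x (c + s); last by rewrite max_r//; exact: ClampHigh.
by have [sx|xs'] := leP (c - s) x; constructor; rewrite ?sx.
Qed.

Lemma clamp_in c s x : 0 <= s -> `|clamp c s x - c| <= s.
Proof.
move=> s0; rewrite ler_norml.
by case: (clampP c s x s0) => ?; apply/andP; split; lra.
Qed.

Lemma clamp_id c s x : 0 <= s -> `|x - c| <= s -> clamp c s x = x.
Proof. by move=> s0; rewrite ler_norml; case: (clampP c s x s0) => ?; lra. Qed.

Lemma clamp_lip c s x y : 0 <= s ->
  `|clamp c s x - clamp c s y| <= `|x - y|.
Proof.
move=> s0; wlog xy : x y / x <= y.
  move=> H; have [/H//|/ltW /H] := leP x y.
  by rewrite distrC [leRHS]distrC.
rewrite distrC [leRHS]distrC [leRHS]ger0_norm ?subr_ge0// ler_norml.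
by case: (clampP c s x s0) => ?; case: (clampP c s y s0) => ?;
  apply/andP; split; lra.
Qed.

(** Averaging [k] against the nonnegative weight F(t) G(x) moves it from [k a b] by at most [M]
    times the total mass, and the reverse triangle inequality concludes. The Hölder bound provides
    the continuity that makes the iterated integrals meaningful. *)
Lemma integral_kernel_lower (F G : R -> R) (k : R -> R -> R) (a b s L d M : R) :
  0 < s -> 0 < L -> 0 < d ->
  continuous F -> continuous G ->
  (forall t, 0 <= F t) -> (forall x, 0 <= G x) ->
  (forall t, s < `|t - a| -> F t = 0) ->
  (forall x, s < `|x - b| -> G x = 0) ->
  (forall t x t' x', `|t - a| <= s -> `|x - b| <= s ->
    `|t' - a| <= s -> `|x' - b| <= s ->
    `|k t x - k t' x'| <= L * (`|t - t'| + `|x - x'|) `^ d) ->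
  (forall t x, `|t - a| <= s -> `|x - b| <= s -> `|k t x - k a b| <= M) ->
  `|k a b| * (Rintegral mu setT F * Rintegral mu setT G) <=
  `|Rintegral mu setT (fun x => Rintegral mu setT (fun t => F t * G x * k t x))|
   + M * (Rintegral mu setT F * Rintegral mu setT G).
Proof.
move=> s0 L0 d0 cF cG F0 G0 FS GS khol kM.
have intF h : continuous h -> mu.-integrable setT (EFin \o (fun t => F t * h t)).
  move=> ch; apply: (@integrable_compact_support _ (a - s) (a + s)).
    by move=> x; apply: continuousM; [exact: cF|exact: ch].
  by move=> x; rewrite -ler_distlC distrC -ltNge => /FS ->; rewrite mul0r.
have intG h : continuous h -> mu.-integrable setT (EFin \o (fun t => G t * h t)).
  move=> ch; apply: (@integrable_compact_support _ (b - s) (b + s)).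
    by move=> x; apply: continuousM; [exact: cG|exact: ch].
  by move=> x; rewrite -ler_distlC distrC -ltNge => /GS ->; rewrite mul0r.
have cst_cont (r : R) : continuous (fun _ : R => r) by move=> x; exact: cvg_cst.
have IF : mu.-integrable setT (EFin \o F).
  have := intF (fun=> 1) (cst_cont 1).
  by congr (integrable _ _ _); apply/funext => x /=; rewrite mulr1.
have IG : mu.-integrable setT (EFin \o G).
  have := intG (fun=> 1) (cst_cont 1).
  by congr (integrable _ _ _); apply/funext => x /=; rewrite mulr1.
(* Clamping makes the kernel continuous on the plane and leaves
   [F t * G x * k t x] unchanged. *)
pose kc t x := k (clamp a s t) (clamp b s x).
have kc_hol t x t' x' :
    `|kc t x - kc t' x'| <= L * (`|t - t'| + `|x - x'|) `^ d.
  apply: le_trans (khol _ _ _ _ _ _ _ _) _; rewrite ?clamp_in ?(ltW s0)//.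
  rewrite ler_pM2l// ge0_ler_powR ?nnegrE ?(ltW d0) ?addr_ge0//.
  by apply: lerD; apply: clamp_lip; exact: ltW.
have kc_M t x : `|kc t x - k a b| <= M.
  by apply: kM; apply: clamp_in; exact: ltW.
have powR_cvg0 (y : R) : (fun z => L * `|y - z| `^ d) @ y --> (0 : R).
  apply/cvgrPdist_le => e e0; near=> z.
  rewrite sub0r normrN ger0_norm ?mulr_ge0 ?powR_ge0 ?(ltW L0)//.
  rewrite mulrC -ler_pdivlMr//.
  have eL : 0 <= e / L by rewrite divr_ge0 ?ltW.
  (* Writing e / L as the d-th power of (e / L)^(1/d) exhibits the radius of the neighbourhood. *)
  rewrite -[leRHS]powRr1// -(mulVf (lt0r_neq0 d0)) powRrM.
  rewrite ge0_ler_powR ?nnegrE ?powR_ge0 ?(ltW d0)//.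
  near: z; apply: cvgr_dist_le; first exact: cvg_id.
  by rewrite powR_gt0 ?divr_gt0.
have kc_cont x : continuous (kc ^~ x).
  move=> t; apply/cvgrPdist_le => e e0.
  have /cvgrPdist_le/(_ e e0) := powR_cvg0 t.
  apply: filterS => t'; rewrite sub0r normrN => H.
  apply: le_trans (le_trans (kc_hol t x t' x) (ler_norm _)) _.
  by rewrite subrr normr0 addr0.
pose J x := Rintegral mu setT (fun t => F t * kc t x).
set IntF := Rintegral mu setT F; set IntG := Rintegral mu setT G.
have IntF0 : 0 <= IntF by apply: Rintegral_ge0 => x _.
have intK x : mu.-integrable setT (EFin \o (fun t => F t * kc t x)).
  by apply: intF; exact: kc_cont.
(* A uniform perturbation of size [e] changes the average against [F] by at most [IntF * e]. This
   serves twice: for the continuity of [J], and for comparing [J] with the constant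
   [IntF * k a b]. *)
have J_le (u c : R -> R) (e : R) : continuous u -> continuous c ->
    (forall t, `|u t - c t| <= e) ->
    `|Rintegral mu setT (fun t => F t * u t) -
      Rintegral mu setT (fun t => F t * c t)| <= IntF * e.
  move=> cu cc uce.
  have iB : mu.-integrable setT (EFin \o (fun t => F t * u t - F t * c t)).
    have := intF (fun t => u t - c t) (fun x => continuousB (cu x) (cc x)).
    by congr (integrable _ _ _); apply/funext => x /=; rewrite mulrBr.
  rewrite -RintegralB//; try exact: intF.
  apply: le_trans (le_normr_Rintegral _ iB) _ => //.
  rewrite /IntF -RintegralZr//; apply: le_Rintegral => //.
  - have := integrable_norm iB; exact.
  - exact: (intF (fun=> e)).
  move=> t _; rewrite -mulrBr normrM (ger0_norm (F0 t)).
  by rewrite ler_wpM2l.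
have J_cont : continuous J.
  move=> x; apply/cvgrPdist_le => e e0.
  have : (fun z => IntF * (L * `|x - z| `^ d)) @ x --> (0 : R).
    by rewrite -(mulr0 IntF); apply: cvgM; [exact: cvg_cst|exact: powR_cvg0].
  move/cvgrPdist_le => /(_ e e0); apply: filterS => x'.
  rewrite sub0r normrN => H; apply: le_trans _ (le_trans (ler_norm _) H).
  apply: J_le => // t; apply: le_trans (kc_hol t x t x') _.
  by rewrite subrr normr0 add0r.
have J_M x : `|J x - IntF * k a b| <= IntF * M.
  have := J_le (kc ^~ x) (fun=> k a b) M (kc_cont x) (cst_cont _)
    (fun t => kc_M t x).
  by rewrite RintegralZr.
have -> : (fun x => Rintegral mu setT (fun t => F t * G x * k t x)) =
    (fun x => G x * J x).
  apply/funext => x; rewrite -RintegralZl//; congr Rintegral.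
  apply/funext => t; rewrite (mulrC (F t)) -mulrA.
  have [xs|/GS ->] := leP `|x - b| s; last by rewrite !mul0r.
  have [ts|/FS ->] := leP `|t - a| s; last by rewrite !(mul0r, mulr0).
  by rewrite /kc !clamp_id ?(ltW s0).
have IGJ : mu.-integrable setT (EFin \o (fun x => G x * J x)) by exact: intG.
(* The same averaging estimate, now in [x] against [G]. *)
have : `|Rintegral mu setT (fun x => G x * J x) - IntF * IntG * k a b|
    <= M * (IntF * IntG).
  have -> : IntF * IntG * k a b = Rintegral mu setT (fun x => G x * (IntF * k a b)).
    by rewrite RintegralZr// mulrA (mulrC IntF).
  move: J_M; set c0 := IntF * k a b => J_M.
  have iB : mu.-integrable setT (EFin \o (fun x => G x * J x - G x * c0)).
    have := intG (fun t => J t - c0)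
      (fun x => continuousB (J_cont x) (cst_cont _ x)).
    by congr (integrable _ _ _); apply/funext => x /=; rewrite mulrBr.
  rewrite -RintegralB//; last exact: (intG (fun=> _)).
  apply: le_trans (le_normr_Rintegral _ iB) _ => //.
  rewrite mulrA [leRHS]mulrC /IntG -RintegralZr//; apply: le_Rintegral => //.
  - have := integrable_norm iB; exact.
  - exact: (intG (fun=> _)).
  move=> t _; rewrite -mulrBr normrM (ger0_norm (G0 t)).
  by rewrite ler_wpM2l// (mulrC M).
have IntG0 : 0 <= IntG by apply: Rintegral_ge0 => x _.
have -> : `|k a b| * (IntF * IntG) = `|IntF * IntG * k a b|.
  by rewrite normrM (ger0_norm (mulr_ge0 IntF0 IntG0)) mulrC.
move=> H; rewrite -lerBlDl; apply: le_trans H.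
by rewrite distrC; apply: lerB_dist.
Unshelve. all: by end_near. Qed.
End integral.

(** * Rescaled bumps as test functions adapted to an interval *)

Section test_functions.
Context {R : realType}.

(** [B] and [c] are chosen before the centre and the width; this uniformity is what makes the final
    decay constant independent of the point. *)
Lemma scaled_bump (N : nat) : exists B c : R, [/\ 0 < B, 0 < c &
  forall x0 s : R, 0 < s -> exists F : R -> R, Cn_real N F /\
    forall x, [/\ 0 <= F x, (`|x - x0| <= s / 2 -> c <= F x),
    (forall n, (n <= N)%N -> `|derive1n n F x| <= B * s ^- n) &
    (s <= `|x - x0| -> forall n, (n <= N)%N -> derive1n n F x = 0)]].
Proof.
have [eta [B [c [B0 c0 [deta ceta] etaP]]]] := @bump_exists R N.
exists B, c; split => // x0 s s0.
have dE := derive1n_affine N eta s^-1 x0 deta.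
have normE x : `|s^-1 * (x - x0)| = `|x - x0| / s.
  by rewrite normrM gtr0_norm ?invr_gt0// mulrC.
exists (fun x => eta (s^-1 * (x - x0))); split.
  split=> [n x nN|].
    rewrite (dE n (ltnW nN)).
    have d1 : is_derive x 1 (fun x => s^-1 * (x - x0) : R^o) s^-1.
      apply: (is_derive_eq (@is_deriveZ _ _ _ (fun x => x - x0) s^-1 _ _ _
        (@is_deriveB _ _ _ id (cst x0) _ _ _ _ (is_derive_id x (1 : R))
          (is_derive_cst _ _ _)))).
      by rewrite /GRing.scale/= subr0 mulr1.
    have d2 := derivableP (deta n (s^-1 * (x - x0)) nN).
    by have [] := is_deriveZ (s^-1 ^+ n) (@is_derive1_comp _ (derive1n n eta)
      (fun x => s^-1 * (x - x0)) _ _ _ d2 d1).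
  rewrite (dE N (leqnn N)) => x; apply: cvgM; first exact: cvg_cst.
  apply: (@continuous_comp _ _ _ (fun x => s^-1 * (x - x0)) (derive1n N eta)).
    by apply: cvgM; [exact: cvg_cst|apply: cvgB; [exact: cvg_id|exact: cvg_cst]].
  exact: ceta.
move=> x; have [eta0 etac etaB etas] := etaP (s^-1 * (x - x0)).
split => //.
- by move=> xs; apply: etac; rewrite normE ler_pdivrMr// mulrC mulrA mulr1.
- move=> n nN; rewrite (dE n nN) normrM normrX gtr0_norm ?invr_gt0//.
  by rewrite exprVn mulrC ler_wpM2r ?invr_ge0 ?exprn_ge0 ?(ltW s0)// etaB.
- move=> xs n nN; rewrite (dE n nN) etas ?mulr0//.
  by rewrite normE ler_pdivlMr// mul1r.
Qed.

Lemma Cn_real_continuous (N : nat) (F : R -> R) : Cn_real N F -> continuous F.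
Proof.
case: N => [|N] [dF cF] x; first exact: cF.
by apply/differentiable_continuous/derivable1_diffP; exact: (dF 0%N x).
Qed.

Lemma normc_real (x : R) : normc (x +i* 0) = `|x|.
Proof. by rewrite /= expr0n addr0 sqrtr_sqr. Qed.

Lemma Re_le_normc (z : R[i]) : `|complex.Re z| <= normc z.
Proof.
case: z => x y /=; rewrite -sqrtr_sqr ler_sqrt ?addr_ge0 ?sqr_ge0//.
by rewrite lerDl sqr_ge0.
Qed.

Lemma Im_le_normc (z : R[i]) : `|complex.Im z| <= normc z.
Proof.
case: z => x y /=; rewrite -sqrtr_sqr ler_sqrt ?addr_ge0 ?sqr_ge0//.
by rewrite lerDr sqr_ge0.
Qed.

Lemma normc_le_ReIm (z : R[i]) :
  normc z <= `|complex.Re z| + `|complex.Im z|.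
Proof.
case: z => x y /=.
rewrite -[leRHS]ger0_norm ?addr_ge0// -[leRHS]sqrtr_sqr.
rewrite ler_sqrt ?sqr_ge0// sqrrD !real_normK ?num_real// lerD2r lerDl.
by rewrite mulrn_wge0 ?mulr_ge0.
Qed.

Lemma cderivn_real (F : R -> R) (n : nat) (x : R) :
  cderivn n (fun x => F x +i* 0) x = derive1n n F x +i* 0.
Proof. by rewrite /cderivn /im/= derive1n_zero. Qed.

Lemma in_SN_real (N : nat) (F : R -> R) (x0 s : R) : 0 <= s -> Cn_real N F ->
  (forall n x, (n <= N)%N -> s <= `|x - x0| -> derive1n n F x = 0) ->
  (forall n, (n <= N)%N -> exists B, forall x, `|derive1n n F x| <= B) ->
  in_SN N (fun x => F x +i* 0).
Proof.
move=> s0 CF FS FB; split.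
  split; first exact: CF.
  by have [] := @Cn_zero R N.
move=> m n mN nN; have [B FBn] := FB n nN.
(* On the ball of radius [s] around [x0] the weight is at most (|x0| + s)^m; off it the derivative
   vanishes. *)
exists ((`|x0| + s) ^+ m * B) => _ [x _ <-]; rewrite cderivn_real normc_real.
have [xs|xs] := leP s `|x - x0|.
  rewrite (FS n x nN xs) normr0 mulr0 mulr_ge0 ?exprn_ge0 ?addr_ge0//.
  exact: le_trans (FBn 0).
apply: ler_pM; rewrite ?exprn_ge0//.
apply: lerXn2r; rewrite ?nnegrE ?addr_ge0//.
rewrite -{1}(subrK x0 x) addrC (le_trans (ler_normD _ _))// lerD2l.
exact: ltW.
Qed.

Lemma supp_subset_ball (F : R -> R) (x0 s : R) :
  (forall x, s <= `|x - x0| -> F x = 0) ->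
  supp (fun x => F x +i* 0) `<=` `[x0 - s, x0 + s].
Proof.
move=> FS; rewrite /supp [X in _ `<=` X](iffLR (closure_id _)); last first.
  exact: itv_closed.
apply: closure_subset => x /= Fx; rewrite in_itv/= -ler_distlC distrC.
rewrite leNgt; apply/negP => /ltW /FS Fx0.
by move: Fx; rewrite Fx0 eqxx.
Qed.

Lemma compact_supp (F : R -> R) (x0 s : R) :
  (forall x, s <= `|x - x0| -> F x = 0) ->
  compact (supp (fun x => F x +i* 0)).
Proof.
move=> /supp_subset_ball FS.
apply: subclosed_compact FS; [exact: closed_closure|exact: segment_compact].
Qed.

(* An unnormalized bump of width comparable to [b - a] is adapted to [a, b]
   with a constant proportional to [(b - a) `^ (1 / 2)]. *)
Lemma adapted_bump_scaled (N : nat) (a b x0 B : R) (F : SN R N) (G : R -> R) :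
  a < b -> 0 < B -> a <= x0 <= b -> (forall x, F x = G x +i* 0) ->
  (forall n x, (n <= N)%N -> `|derive1n n G x| <= B * ((b - a) / 16) ^- n) ->
  (forall n x, (n <= N)%N -> (b - a) / 16 <= `|x - x0| -> derive1n n G x = 0) ->
  adapted_bump a b (B * 32 ^+ N * (b - a) `^ (1 / 2)) F.
Proof.
move=> ab B0 /andP[ax xb] FG GB GS n x nN.
have -> : SN_fun F = (fun x => G x +i* 0) by apply/funext.
rewrite cderivn_real normc_real.
set r := b - a; have r0 : 0 < r by rewrite subr_gt0.
(* The factor r^(1/2) cancels the L^2 normalization. *)
have -> : B * 32 ^+ N * r `^ (1 / 2) * r `^ (- (1 / 2) - n%:R) =
    B * 32 ^+ N * r ^- n.
  rewrite -mulrA -powRD; last by rewrite (gt_eqF r0) implybT.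
  have -> : 1 / 2 + (- (1 / 2) - n%:R) = - n%:R :> R by lra.
  by rewrite powRN powR_mulrn ?ltW.
have pos y : 0 < 1 + r^-1 * `|y| by rewrite ltr_wpDr// mulr_ge0// invr_ge0 ltW.
have [xs|xs] := leP (r / 16) `|x - x0|.
  rewrite (GS n x nN xs) normr0 mulr_ge0//.
    by rewrite !mulr_ge0 ?invr_ge0 ?exprn_ge0// ltW.
  by rewrite invr_ge0 exprn_ge0// ltW.
apply: (le_trans (GB n x nN)); rewrite -/r.
(* A point within r/16 of [x0] lies at most r/2 + r/16 < r from the midpoint, so the decay factor is
   at least 2^(-N). *)
have x2 : 1 + r^-1 * `|x - (a + b) / 2| <= 2.
  suff : r^-1 * `|x - (a + b) / 2| <= 1 by lra.
  rewrite mulrC ler_pdivrMr// mul1r.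
  by move: xs; rewrite ltr_norml ler_norml /r => /andP[? ?]; apply/andP; split; lra.
apply: (@le_trans _ _ (B * 32 ^+ N * r ^- n * 2 ^- N)); last first.
  apply: ler_wpM2l; first by rewrite !mulr_ge0 ?invr_ge0 ?exprn_ge0// ltW.
  by rewrite lef_pV2 ?posrE ?exprn_gt0// lerXn2r ?nnegrE// ltW.
have -> : (r / 16) ^- n = r ^- n * 16 ^+ n by rewrite expr_div_n invf_div mulrC.
(* The constant splits as 32 = 2 * 16: 2^N pays for the decay factor, and 16^N >= 16^n for
   derivatives at width r/16. *)
have -> : 32 ^+ N = 2 ^+ N * 16 ^+ N :> R by rewrite -exprMn; congr (_ ^+ _); lra.
have -> : B * (2 ^+ N * 16 ^+ N) * r ^- n * 2 ^- N = B * (r ^- n * 16 ^+ N).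
  by field; rewrite ?expf_neq0 ?(gt_eqF r0).
rewrite ler_wpM2l ?(ltW B0)// ler_wpM2l ?invr_ge0 ?exprn_ge0 ?(ltW r0)//.
by rewrite ler_weXn2l// ler1n.
Qed.

End test_functions.

(** * The decay estimate from weak boundedness *)

Theorem lemma3p4 (R : realType) (K : R -> R -> R[i])
  (K_smooth : kernel_smoothness K)
  (N : nat) (N_ge1 : (1 <= N)%N)
  (T : {linear SN R N -> SN_dual R N})
  (T_continuous : continuous T)
  (T_associated : kernel_associated T K)
  (T_weakly_bounded : weakly_bounded T) :
  kernel_decay K.
Proof.
have [d [C [d0 _ C0 Ksm]]] := K_smooth.
have [A Awb] := T_weakly_bounded.
have [B [c [B0 c0 bumps]]] := @scaled_bump R N.
(* The constant in weak boundedness comes without a sign, hence [|A|]. The square is that of the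
   adaptation constant without its factor r^(1/2). *)
pose A' := `|A| * (B * 32 ^+ N) ^+ 2.
have A'0 : 0 <= A' by rewrite mulr_ge0 ?sqr_ge0.
(* Both integrals are at least c r / 16, so dividing by their product yields 256 / c^2; the summand
   [C] accounts for the oscillation of the kernel. *)
pose D := 256 * A' / c ^+ 2 + C.
have D0 : 0 < D by rewrite ltr_wpDl// divr_ge0 ?sqr_ge0// mulr_ge0.
(* The factor 2 comes from adding the bounds for the real and imaginary parts. *)
exists (2 * D) => [|t0 x0 tx]; first by rewrite mulr_gt0.
pose a := Num.min t0 x0; pose b := Num.max t0 x0.
pose r := `|t0 - x0|.
have r0 : 0 < r by rewrite normr_gt0 subr_eq0.
have ba : b - a = r.
  rewrite /a /b /r; case: (leP t0 x0) => tx'; last by rewrite gtr0_norm ?subr_gt0.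
  by rewrite distrC ger0_norm ?subr_ge0.
have ab : a < b by rewrite -subr_gt0 ba.
have at0 : a <= t0 <= b by rewrite /a /b ge_min le_max !lexx.
have ax0 : a <= x0 <= b by rewrite /a /b ge_min le_max !lexx !orbT.
pose s := r / 16; have s0 : 0 < s by rewrite divr_gt0.
have [F [CF FP]] := bumps t0 s s0; have [G [CG GP]] := bumps x0 s s0.
have F0 x : 0 <= F x by have [] := FP x.
have G0 x : 0 <= G x by have [] := GP x.
have FS n x : (n <= N)%N -> s <= `|x - t0| -> derive1n n F x = 0.
  by move=> nN xs; have [_ _ _ ->] := FP x.
have GS n x : (n <= N)%N -> s <= `|x - x0| -> derive1n n G x = 0.
  by move=> nN xs; have [_ _ _ ->] := GP x.
have FB n x : (n <= N)%N -> `|derive1n n F x| <= B * s ^- n.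
  by move=> nN; have [_ _ /(_ n nN)] := FP x.
have GB n x : (n <= N)%N -> `|derive1n n G x| <= B * s ^- n.
  by move=> nN; have [_ _ /(_ n nN)] := GP x.
have F_SN : (fun x => F x +i* 0 : R[i]^o) \in SN_pred N.
  apply/asboolP; apply: (in_SN_real N F t0 s (ltW s0) CF FS) => n nN.
  by exists (B * s ^- n) => x; exact: FB.
have G_SN : (fun x => G x +i* 0 : R[i]^o) \in SN_pred N.
  apply/asboolP; apply: (in_SN_real N G x0 s (ltW s0) CG GS) => n nN.
  by exists (B * s ^- n) => x; exact: GB.
pose f := MkSN F_SN; pose g := MkSN G_SN.
have Tfg_le : normc (T f g) <= A' * r.
  have C1 : 0 < B * 32 ^+ N * (b - a) `^ (1 / 2).
    by rewrite mulr_gt0 ?powR_gt0 ?mulr_gt0 ?exprn_gt0// subr_gt0.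
  have := Awb a b _ ab C1 f g.
  have ff : adapted_bump a b (B * 32 ^+ N * (b - a) `^ (1 / 2)) f.
    by apply: (adapted_bump_scaled N a b t0 B f F) => //; rewrite ba.
  have gg : adapted_bump a b (B * 32 ^+ N * (b - a) `^ (1 / 2)) g.
    by apply: (adapted_bump_scaled N a b x0 B g G) => //; rewrite ba.
  move=> /(_ ff gg) /le_trans; apply.
  rewrite exprMn ba -(powR_mulrn 2 (powR_ge0 r (1 / 2))) -powRrM.
  have -> : 1 / 2 * 2%:R = 1 :> R by lra.
  rewrite powRr1 ?(ltW r0)// mulrA ler_wpM2r ?(ltW r0)//.
  by rewrite ler_wpM2r ?sqr_ge0// ler_norm.
have F_out x : s <= `|x - t0| -> F x = 0 by exact: (FS 0%N x (leq0n N)).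
have G_out x : s <= `|x - x0| -> G x = 0 by exact: (GS 0%N x (leq0n N)).
have TfgE : T f g = cintegral (fun x => cintegral (fun t => f t * g x * K t x)).
  apply: T_associated; first exact: compact_supp F_out.
    exact: compact_supp G_out.
  (* A common point of the supports would force r <= 2 s = r / 8. *)
  apply/seteqP; split=> // x [/(supp_subset_ball F t0 s F_out)].
  rewrite /= in_itv/= => /andP[? ?] /(supp_subset_ball G x0 s G_out).
  rewrite /= in_itv/= => /andP[? ?].
  have : r <= 2 * s by rewrite /r ler_norml; apply/andP; split; lra.
  by rewrite /s => ?; lra.
pose IF := Rintegral lebesgue_measure setT F.
pose IG := Rintegral lebesgue_measure setT G.
have cF := Cn_real_continuous N F CF; have cG := Cn_real_continuous N G CG.
have I_ge (H : R -> R) (y : R) : continuous H -> (forall x, 0 <= H x) ->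
    (forall x, s <= `|x - y| -> H x = 0) ->
    (forall x, `|x - y| <= s / 2 -> c <= H x) ->
    c * s <= Rintegral lebesgue_measure setT H.
  move=> cH H0 HS Hc.
  have := Rintegral_ge_cst H (y - s / 2) (y + s / 2) c.
  have -> : y + s / 2 - (y - s / 2) = s by lra.
  apply => //; first by lra.
    apply: (integrable_compact_support H (y - s) (y + s) cH) => x.
    by rewrite -ler_distlC distrC -ltNge => /ltW /HS.
  by move=> x; rewrite -ler_distlC distrC => /Hc.
have IF_ge : c * s <= IF.
  by apply: (I_ge F t0) => // x xs; have [_ ->] := FP x.
have IG_ge : c * s <= IG.
  by apply: (I_ge G x0) => // x xs; have [_ ->] := GP x.
(* The averaging lemma concerns real kernels. It is applied with [p] the real and the imaginary
   part, which pass through the integrals because [F] and [G] are real. *)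
have component_le (p : R[i] -> R) : (forall z, `|p z| <= normc z) ->
    (forall z w, p (z - w) = p z - p w) ->
    p (T f g) = Rintegral lebesgue_measure setT (fun x =>
      Rintegral lebesgue_measure setT (fun t => F t * G x * p (K t x))) ->
    `|p (K t0 x0)| <= D / r.
  move=> p_le pB pT.
  have cs0 : 0 < c * s by rewrite mulr_gt0.
  have IFG0 : 0 < IF * IG by rewrite mulr_gt0// (lt_le_trans cs0).
  (* The lower bound r - 2 s = 7 r / 8 on the box makes the denominator in the smoothness condition
     uniform, giving the Hölder constant below. *)
  have box t x : `|t - t0| <= s -> `|x - x0| <= s -> 7 / 8 * r <= `|t - x|.
    move=> ts xs.
    have : r <= s + `|t - x| + s.
      have -> : r = `|- (t - t0) + (t - x) + (x - x0)|.
        by rewrite /r; congr `|_|; ring.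
      rewrite (le_trans (ler_normD _ _))// lerD// (le_trans (ler_normD _ _))//.
      by rewrite normrN lerD2r.
    by rewrite /s; lra.
  have L0 : 0 < C / (7 / 8 * r) `^ (1 + d).
    by rewrite divr_gt0// powR_gt0// mulr_gt0//; lra.
  have := @integral_kernel_lower R F G (fun t x => p (K t x)) t0 x0 s
    (C / (7 / 8 * r) `^ (1 + d)) d (C / r) s0 L0 d0 cF cG F0 G0.
  move=> /(_ (fun t ts => F_out t (ltW ts)) (fun t ts => G_out t (ltW ts))).
  rewrite -pT -/IF -/IG => kernel_lower.
  have {kernel_lower} : `|p (K t0 x0)| * (IF * IG) <=
      `|p (T f g)| + C / r * (IF * IG).
    apply: kernel_lower => [t x t' x' ts xs ts' xs'|t x ts xs].
      rewrite -pB; apply: (le_trans (p_le _)).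
      have tx7 := box t x ts xs.
      (* Two points of the box differ by at most 4 s = r / 4 in total, and twice this is below 7 r /
         8. *)
      apply: le_trans (Ksm t x t' x' _) _.
        have tt : `|t - t'| <= 2 * s.
          by move: ts ts'; rewrite !ler_norml => /andP[? ?] /andP[? ?];
            apply/andP; split; lra.
        have xx : `|x - x'| <= 2 * s.
          by move: xs xs'; rewrite !ler_norml => /andP[? ?] /andP[? ?];
            apply/andP; split; lra.
        by apply: lt_le_trans tx7; move: tt xx; rewrite /s; lra.
      rewrite -mulrA ler_wpM2l ?(ltW C0)// mulrC ler_wpM2r ?powR_ge0//.
      have r7 : 0 < 7 / 8 * r by rewrite mulr_gt0//; lra.
      rewrite lef_pV2 ?posrE ?powR_gt0// ?(lt_le_trans r7)//.
      by rewrite ge0_ler_powR ?nnegrE ?(ltW r7)// addr_ge0 ?ltW.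
    (* The difference is reversed so that smoothness is based at (t0, x0): the denominator is then
       exactly r^(1 + d), and the bound becomes C / r. *)
    rewrite distrC -pB; apply: (le_trans (p_le _)).
    have txs : `|t0 - t| + `|x0 - x| <= r / 8.
      by rewrite distrC (distrC x0); move: ts xs; rewrite /s; lra.
    apply: le_trans (Ksm t0 x0 t x _) _; first by rewrite -/r; lra.
    rewrite ler_wpM2l ?(ltW C0)// ler_pdivrMr ?powR_gt0//.
    rewrite powRD; last by rewrite (gt_eqF r0) implybT.
    rewrite powRr1 ?(ltW r0)// mulrA mulVf ?(gt_eqF r0)// mul1r.
    rewrite ge0_ler_powR ?nnegrE ?addr_ge0 ?(ltW d0)//.
    by apply: (le_trans txs); rewrite -/r; lra.
  move=> low; rewrite -(ler_pM2r IFG0); apply: (le_trans low).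
  rewrite /D [(_ + C) / r]mulrDl mulrDl lerD2r.
  apply: (le_trans (p_le _)); apply: (le_trans Tfg_le).
  have -> : A' * r = 256 * A' / c ^+ 2 / r * (c * s * (c * s)).
    by rewrite /s; field; rewrite (gt_eqF r0) (gt_eqF c0).
  rewrite ler_wpM2l//; last by apply: ler_pM => //; exact: ltW.
  by rewrite !mulr_ge0 ?invr_ge0 ?sqr_ge0// ltW.
apply: (le_trans (normc_le_ReIm _)); rewrite mul1r -/r -mulrA.
rewrite mulr_natl mulr2n; apply: lerD;
  [apply: (component_le (@complex.Re R))|apply: (component_le (@complex.Im R))].
- exact: Re_le_normc.
- by case=> ? ? [].
- rewrite TfgE /=; congr Rintegral; apply/funext => x; rewrite /re /=.
  congr Rintegral; apply/funext => t; rewrite /re !Defs.ReM !Defs.ImM /=.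
  by rewrite !mulr0 !mul0r !addr0 mul0r !subr0.
- exact: Im_le_normc.
- by case=> ? ? [].
- rewrite TfgE /=; congr Rintegral; apply/funext => x; rewrite /im /=.
  congr Rintegral; apply/funext => t; rewrite /im !Defs.ImM !Defs.ReM /=.
  by rewrite !mulr0 !mul0r !addr0 mul0r addr0 subr0.
Qed.
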